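(* Let $F_X$ and $F_Y$ be continuous cdfs and for each $n$ let $X_1,\dots,X_n$ be an i.i.d. sample from $F_X$ and $Y_1,\dots,Y_n$ an i.i.d. sample from $F_Y$, the two samples independent. Let $(\gamma_n)$ be $[0,1]$-valued with $|\gamma_n-\gamma|=O(1/n)$ for some $\gamma\in[0,1]$, and write $k_n=1+[(n-1)\gamma_n]$. If $\operatorname{dist}(\gamma,A_0)>0$ then $\liminf_{n\to\infty}P(X_{k_n:n}\le Y_{k_n:n})\ge 1/2$ (i.e. $X_{k_n:n}\le_{\textnormal{asp}}Y_{k_n:n}$). If $\operatorname{dist}(\gamma,A_2)>0$ then $\lim_{n\to\infty}P(X_{k_n:n}\le Y_{k_n:n})=1/2$ (i.e. $X_{k_n:n}=_{\textnormal{asp}}Y_{k_n:n}$).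
   Context: $F^{-1}(u)=\inf\{x:F(x)\ge u\}$. $A_0=\{u\in(0,1):F_X^{-1}(u)>F_Y^{-1}(u)\}$, $A_2=\{u\in(0,1):F_X^{-1}(u)\neq F_Y^{-1}(u)\}$. $\operatorname{dist}(x,A)=\inf\{|x-y|:y\in A\}$ (with $\inf\emptyset=+\infty$). $X_{k:n}$ denotes the $k$-th smallest among $X_1,\dots,X_n$; $[x]$ is the integer part. *)

(* Defs.v *)
From HB Require Import structures.
From mathcomp Require Import all_boot all_order all_algebra.
From mathcomp Require Import all_classical all_reals all_analysis.
Set Implicit Arguments. Unset Strict Implicit. Unset Printing Implicit Defensive.
Import Order.TTheory GRing.Theory Num.Theory.
Import numFieldNormedType.Exports.
Local Open Scope classical_set_scope.
Local Open Scope ring_scope.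

Definition qinv {R : realType} (F : R -> R) (u : R) : R := inf [set x | u <= F x].

Definition A0 {R : realType} (FX FY : R -> R) : set R :=
  [set u | 0 < u < 1 /\ qinv FY u < qinv FX u].

Definition A2 {R : realType} (FX FY : R -> R) : set R :=
  [set u | 0 < u < 1 /\ qinv FX u <> qinv FY u].

(* dist(x, A) = inf {|x - y| : y in A}, in the extended reals (inf of empty = +oo) *)
Definition dist {R : realType} (x : R) (A : set R) : \bar R :=
  ereal_inf [set (`|x - y|)%:E | y in A].

(* k-th order statistic (k >= 1) of Z_0, ..., Z_{n-1} at outcome t:
   the k-th smallest value. *)
Definition ostat {T : Type} {R : realType} (Z : nat -> T -> R) (n k : nat) (t : T) : R :=
  nth 0 (sort <=%R [seq Z i t | i <- iota 0 n]) k.-1.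

Definition kn {R : realType} (g : nat -> R) (n : nat) : nat :=
  (1 + `|Num.floor ((n.-1)%:R * g n)|)%N.

Definition has_cdf {d} {T : measurableType d} {R : realType}
  (P : probability T R) (Z : T -> R) (F : R -> R) : Prop :=
  forall x : R, P [set t | Z t <= x] = (F x)%:E.

(* Mutual independence of the 2n random variables X_0..X_{n-1}, Y_0..Y_{n-1}:
   product rule for preimages of arbitrary measurable sets (taking some of the
   sets to be the whole line gives the product rule for every subfamily). *)
Definition indep2 {d} {T : measurableType d} {R : realType}
  (P : probability T R) (n : nat) (X Y : nat -> T -> R) : Prop :=
  forall B C : nat -> set R,
    (forall i, measurable (B i)) -> (forall i, measurable (C i)) ->
    P (\bigcap_(i in `I_n) (X i @^-1` B i) `&` \bigcap_(i in `I_n) (Y i @^-1` C i)) =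
    (\prod_(i < n) P (X i @^-1` B i) * \prod_(i < n) P (Y i @^-1` C i))%E.

(* Main.v *)
(** Cut the line at the quantiles [q_j] of order [j / (N + 1)]. By continuity of
    the cdfs, the cells containing the [X_i] and the [Y_i] are i.i.d. uniform on
    [N + 1] cells, whatever [F_X] and [F_Y] are. In this finite uniform model the
    two order statistics are exchangeable and tie with probability at most
    [n^2 / (N + 1)], so the discretised [X_(k)] is below the discretised [Y_(k)]
    with probability nearly [1/2]; by Chebyshev's inequality it also lies near
    [gam]. On that event the cell [j] of [X_(k)] gives
    [X_(k) <= q_X((j + 1) / (N + 1)) <= q_Y((j + 1) / (N + 1)) < Y_(k)], the
    middle inequality because [(j + 1) / (N + 1)] is not in [A0]. Taking
    [N = n^3], every error is [O(1 / n)]. The second claim follows by exchanging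
    [X] and [Y], as the inequality obtained is strict. *)

Require Import Defs.
From HB Require Import structures.
From mathcomp Require Import all_boot all_order all_algebra.
From mathcomp Require Import all_classical all_reals all_analysis.
From mathcomp Require Import ring lra.
Set Implicit Arguments. Unset Strict Implicit. Unset Printing Implicit Defensive.
Import Order.TTheory GRing.Theory Num.Theory.
Import numFieldNormedType.Exports.
Local Open Scope classical_set_scope.
Local Open Scope ring_scope.

(** * Product weights on finite function spaces *)

(** The mass of the outcome [a] when its coordinates are independent with common law [w]. *)
Definition wprod {R : realFieldType} {I K : finType} (w : K -> R)
  (a : {ffun I -> K}) : R := \prod_i w (a i).

Lemma wprod_ge0 (R : realFieldType) (I K : finType) (w : K -> R)
  (a : {ffun I -> K}) : (forall x, 0 <= w x) -> 0 <= wprod w a.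
Proof. by move=> w0; apply: prodr_ge0 => i _. Qed.

(** Expanding the product of sums gives one term per function [a]: expectations factor over
    independent coordinates. The moments below take [F i] constantly 1 off the coordinates of
    interest. *)
Lemma sum_wprod_prod (R : realFieldType) (I K : finType) (w : K -> R)
  (F : I -> K -> R) :
  \sum_(a : {ffun I -> K}) wprod w a * \prod_i F i (a i) =
  \prod_i \sum_x w x * F i x.
Proof.
by rewrite bigA_distr_bigA /=; apply: eq_bigr => a _; rewrite big_split.
Qed.

Lemma sum_wprod (R : realFieldType) (I K : finType) (w : K -> R) :
  \sum_x w x = 1 -> \sum_(a : {ffun I -> K}) wprod w a = 1.
Proof.
move=> w1; transitivity (\sum_(a : {ffun I -> K}) wprod w a * \prod_(i : I) 1).
  by apply: eq_bigr => a _; rewrite big1_eq mulr1.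
rewrite (sum_wprod_prod w (fun _ _ => 1)) big1 // => i _.
by under eq_bigr do rewrite mulr1.
Qed.

Lemma sum_wprod_at2 (R : realFieldType) (I K : finType) (w : K -> R)
  (i j : I) (F G : K -> R) : \sum_x w x = 1 -> i != j ->
  \sum_(a : {ffun I -> K}) wprod w a * (F (a i) * G (a j)) =
  (\sum_x w x * F x) * (\sum_x w x * G x).
Proof.
move=> w1 ij.
pose H l x := if l == i then F x else if l == j then G x else 1.
transitivity (\sum_(a : {ffun I -> K}) wprod w a * \prod_l H l (a l)).
  apply: eq_bigr => a _; congr (_ * _).
  rewrite (bigD1 i) //= (bigD1 j) 1?eq_sym //= big1 ?mulr1.
    by rewrite /H !eqxx [j == i]eq_sym (negbTE ij).
  by move=> l /andP[/negbTE li /negbTE lj]; rewrite /H li lj.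
rewrite sum_wprod_prod (bigD1 i) //= (bigD1 j) 1?eq_sym //=.
rewrite [X in _ * (_ * X)]big1 ?mulr1.
  by rewrite /H !eqxx [j == i]eq_sym (negbTE ij).
move=> l /andP[/negbTE li /negbTE lj]; rewrite /H li lj.
by under eq_bigr do rewrite mulr1.
Qed.

Lemma sum_wprod_at (R : realFieldType) (I K : finType) (w : K -> R)
  (i : I) (F : K -> R) : \sum_x w x = 1 ->
  \sum_(a : {ffun I -> K}) wprod w a * F (a i) = \sum_x w x * F x.
Proof.
move=> w1; pose H l x := if l == i then F x else 1.
transitivity (\sum_(a : {ffun I -> K}) wprod w a * \prod_l H l (a l)).
  apply: eq_bigr => a _; congr (_ * _).
  rewrite (bigD1 i) //= big1 ?mulr1 ?/H ?eqxx // => l /negbTE li.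
  by rewrite li.
rewrite sum_wprod_prod (bigD1 i) //= [X in _ * X]big1 ?mulr1 ?/H ?eqxx //.
move=> l /negbTE ->.
by under eq_bigr do rewrite mulr1.
Qed.

Lemma sum_wprod_tie (R : realFieldType) (I K : finType) (w : K -> R)
  (i j : I) : \sum_x w x = 1 -> i != j ->
  \sum_(a : {ffun I -> K} | a i == a j) wprod w a = \sum_x w x ^+ 2.
Proof.
move=> w1 ij; rewrite big_mkcond /=.
have pick x : \sum_y w y * (y == x)%:R = w x.
  rewrite (bigD1 x) //= eqxx mulr1 big1 ?addr0 // => y /negbTE ->.
  by rewrite mulr0.
(* Splitting along the common value [x] turns the tie into products of indicators of two distinct
   coordinates. *)
transitivity (\sum_(a : {ffun I -> K}) \sum_x
    wprod w a * ((a i == x)%:R * (a j == x)%:R)).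
  apply: eq_bigr => a _; rewrite -big_distrr /= (bigD1 (a i)) //= eqxx mul1r.
  rewrite big1 ?addr0 => [|x]; last first.
    by rewrite eq_sym => /negbTE ->; rewrite mul0r.
  by rewrite eq_sym; case: eqP; rewrite ?mulr1 ?mulr0.
rewrite exchange_big /=; apply: eq_bigr => x _.
rewrite (sum_wprod_at2 (fun y => (y == x)%:R) (fun y => (y == x)%:R)) //.
by rewrite pick expr2.
Qed.

(* The variance of each indicator is bounded by 1. *)
Lemma sum_wprod_chebyshev (R : realFieldType) (I K L : finType) (w : K -> R)
  (h : L -> I) (A : pred K) (r : R) : injective h ->
  (forall x, 0 <= w x) -> \sum_x w x = 1 -> 0 < r ->
  \sum_(a : {ffun I -> K} |
      r <= `|#|[pred l | A (a (h l))]|%:R - #|L|%:R * \sum_(x | A x) w x|)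
    wprod w a <= #|L|%:R / r ^+ 2.
Proof.
move=> hI w0 w1 r0; set p := \sum_(x | A x) w x.
have p0 : 0 <= p by apply: sumr_ge0.
have p1 : p <= 1.
  by rewrite -w1 [leRHS](bigID A) /= lerDl sumr_ge0.
pose D x : R := (A x)%:R - p.
have D0 : \sum_x w x * D x = 0.
  under eq_bigr do rewrite mulrBr.
  rewrite sumrB -big_distrl /= w1 mul1r /p [in X in _ - X]big_mkcond /=.
  rewrite -sumrB big1 // => x _.
  by case: (A x); rewrite ?mulr1 ?mulr0 subrr.
have D2 : \sum_x w x * (D x * D x) <= 1.
  rewrite -w1; apply: ler_sum => x _; rewrite ler_piMr //.
  by rewrite /D; case: (A x) => /=; nra.
have SE (a : {ffun I -> K}) :
    #|[pred l | A (a (h l))]|%:R - #|L|%:R * p = \sum_l D (a (h l)).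
  rewrite /D sumrB sumr_const mulr_natl; congr (_ - _).
  rewrite -sum1_card natr_sum /= big_mkcond /=.
  by apply: eq_bigr => l _; rewrite inE; case: (A _).
have V : \sum_(a : {ffun I -> K}) wprod w a * (\sum_l D (a (h l))) ^+ 2
    <= #|L|%:R.
  have -> : \sum_(a : {ffun I -> K}) wprod w a * (\sum_l D (a (h l))) ^+ 2 =
      \sum_(a : {ffun I -> K}) \sum_l \sum_m
        wprod w a * (D (a (h l)) * D (a (h m))).
    apply: eq_bigr => a _; rewrite expr2 big_distrlr /= big_distrr /=.
    by apply: eq_bigr => l _; rewrite big_distrr.
  rewrite exchange_big /= -sum1_card natr_sum; apply: ler_sum => l _.
  (* Distinct coordinates are independent and [D] is centred, so only the diagonal terms survive. *)
  rewrite exchange_big /= (bigD1 l) //= [X in _ + X]big1 ?addr0 => [|m ml].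
    by rewrite (sum_wprod_at (h l) (fun x => D x * D x)).
  by rewrite sum_wprod_at2 // 1?eq_sym ?inj_eq // D0 mul0r.
rewrite ler_pdivlMr ?exprn_gt0 // big_distrl /=; apply: le_trans V.
rewrite big_mkcond /=; apply: ler_sum => a _; rewrite SE.
have wa := wprod_ge0 a w0; case: ifP => [rS|_]; last by rewrite mulr_ge0 ?sqr_ge0.
by rewrite ler_wpM2l // -[leRHS]real_normK ?num_real // lerXn2r // nnegrE ltW.
Qed.

(** * Order statistics through counting *)

(** After sorting, the entries at most [x] form a prefix, whose length is their number in [s]. *)
Lemma nth_sort_le (disp : Order.disp_t) (T : orderType disp) (x0 x : T)
  (s : seq T) (j : nat) : (j < size s)%N ->
  (nth x0 (sort <=%O s) j <= x)%O = (j < count (<= x)%O s)%N.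
Proof.
move=> js; rewrite -(count_sort <=%O); have ss := sort_le_sorted s.
case: ltnP => c; first exact: nth_count_le.
by apply/negbTE; rewrite -ltNge nth_count_gt // c size_sort.
Qed.

Definition ordnat n (k : nat) (b : 'I_n -> nat) : nat :=
  nth 0%N (sort leq [seq b i | i <- enum 'I_n]) k.-1.

(** Counts are what Chebyshev's inequality controls, and they can be compared between the samples
    and their cells. *)
Lemma ordnat_le n k (b : 'I_n -> nat) j : (0 < k <= n)%N ->
  (ordnat k b <= j)%N = (k <= #|[pred i | b i <= j]%N|)%N.
Proof.
case: k => // k kn; rewrite /ordnat /=.
have := @nth_sort_le _ nat 0%N j [seq b i | i <- enum 'I_n] k.
rewrite size_map size_enum_ord => /(_ kn); rewrite leEnat => ->.
by rewrite count_map -size_filter enumT cardE.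
Qed.

Lemma ordnat_in n k (b : 'I_n -> nat) : (0 < k <= n)%N ->
  exists i, ordnat k b = b i.
Proof.
case: k => // k kn.
have : ordnat k.+1 b \in [seq b i | i <- enum 'I_n].
  by rewrite -(mem_sort leq) mem_nth // size_sort size_map size_enum_ord.
by case/mapP => i _ ->; exists i.
Qed.

Lemma ostat_le (T : Type) (R : realType) (Z : nat -> T -> R) n k t x :
  (0 < k <= n)%N ->
  (ostat Z n k t <= x) = (k <= #|[pred i : 'I_n | (Z i t <= x)%R]|)%N.
Proof.
case: k => // k kn; rewrite /ostat /= nth_sort_le ?size_map ?size_iota //.
by rewrite -val_enum_ord -map_comp count_map -size_filter enumT cardE.
Qed.

(* The two order statistics are exchangeable, and they can only coincide when
   some coordinate of the first sample equals one of the second. *)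
Lemma sum_wprod_ordnat_lt (R : realFieldType) (N n k : nat) (w : 'I_N -> R) :
  (0 < k <= n)%N -> (forall x, 0 <= w x) -> \sum_x w x = 1 ->
  1 - (n ^ 2)%:R * \sum_x w x ^+ 2 <=
  2 * \sum_(a : {ffun bool * 'I_n -> 'I_N} |
     (ordnat k (fun i => a (true, i)) < ordnat k (fun i => a (false, i)))%N)
       wprod w a.
Proof.
move=> kn w0 w1.
pose o b (a : {ffun bool * 'I_n -> 'I_N}) := ordnat k (fun i => a (b, i)).
rewrite -/(o true _) -/(o false _).
pose sw (a : {ffun bool * 'I_n -> 'I_N}) :=
  [ffun z : bool * 'I_n => a (~~ z.1, z.2)].
have swK : involutive sw.
  by move=> a; apply/ffunP => -[b i]; rewrite !ffunE /= negbK.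
have osw b a : o b (sw a) = o (~~ b) a.
  rewrite /o /ordnat; congr (nth _ (sort _ _) _).
  by apply: eq_map => i; rewrite ffunE.
have sym : \sum_(a | (o false a < o true a)%N) wprod w a =
           \sum_(a | (o true a < o false a)%N) wprod w a.
  rewrite (reindex_inj (inv_inj swK)) /=; apply: eq_big => a.
    by rewrite !osw.
  move=> _; rewrite /wprod.
  have swI : involutive (fun z : bool * 'I_n => (~~ z.1, z.2)).
    by case=> b i /=; rewrite negbK.
  rewrite (reindex_inj (inv_inj swI)) /=; apply: eq_bigr => -[b i] _.
  by rewrite ffunE /= negbK.
have tie : \sum_(a | o true a == o false a) wprod w a <=
    (n ^ 2)%:R * \sum_x w x ^+ 2.
  (* Union bound over the pairs of one coordinate from each sample. *)
  have -> : (n ^ 2)%:R * \sum_x w x ^+ 2 = \sum_(ij : 'I_n * 'I_n)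
      \sum_(a : {ffun bool * 'I_n -> 'I_N} | a (true, ij.1) == a (false, ij.2))
        wprod w a.
    rewrite [RHS](eq_bigr (fun=> \sum_x w x ^+ 2)) => [|ij _].
      by rewrite sumr_const card_prod card_ord mulr_natl mulnn.
    by rewrite sum_wprod_tie.
  rewrite big_mkcond (eq_bigr _ (fun ij _ => big_mkcond _ _)) /= exchange_big /=.
  apply: ler_sum => a _.
  have pos (ij : 'I_n * 'I_n) : 0 <=
      (if a (true, ij.1) == a (false, ij.2) then wprod w a else 0).
    by case: ifP => // _; exact: wprod_ge0.
  case: ifP => [/eqP oo|_]; last exact: sumr_ge0.
  have [i oi] := ordnat_in (fun i => a (true, i)) kn.
  have [j oj] := ordnat_in (fun i => a (false, i)) kn.
  rewrite (bigD1 (i, j)) //= ifT ?lerDl ?sumr_ge0 //.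
  by apply/eqP/val_inj; rewrite /= -oi -oj.
(* The total mass 1 splits into the ties and the two strict orderings, which have equal mass by
   [sym]. *)
have := @sum_wprod R (bool * 'I_n)%type 'I_N w w1.
rewrite (bigID (fun a => o true a == o false a)) /=.
rewrite [X in _ + X](bigID (fun a => (o true a < o false a)%N)) /=.
have -> : \sum_(a | (o true a != o false a) && (o true a < o false a)%N)
    wprod w a = \sum_(a | (o true a < o false a)%N) wprod w a.
  by apply: eq_bigl => a; case: ltngtP.
have -> : \sum_(a | (o true a != o false a) && ~~ (o true a < o false a)%N)
    wprod w a = \sum_(a | (o false a < o true a)%N) wprod w a.
  by apply: eq_bigl => a; case: ltngtP.
rewrite sym; move: tie; lra.
Qed.

(** * Events determined by finitely many discrete variables *)

(** A finite union of cylinders, one per admissible configuration: measurability and probability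
    then only have to be checked on events that fix every coordinate. *)
Lemma fin_predE (T : Type) (I K : finType) (c : I -> T -> K)
  (Q : pred {ffun I -> K}) :
  [set t | Q [ffun i => c i t]] =
  \bigcup_(a in [set` enum Q]) \bigcap_i [set t | c i t = a i].
Proof.
apply/seteqP; split => t /=.
  move=> Qt; exists [ffun i => c i t]; first by rewrite /= mem_enum.
  by move=> i _ /=; rewrite ffunE.
case=> a /=; rewrite mem_enum => Qa ca.
by have -> : [ffun i => c i t] = a by apply/ffunP => i; rewrite ffunE ca.
Qed.

Lemma measurable_fin_pred (d : measure_display) (T : measurableType d)
  (I K : finType) (c : I -> T -> K) (Q : pred {ffun I -> K}) :
  (forall i x, measurable [set t | c i t = x]) ->
  measurable [set t | Q [ffun i => c i t]].
Proof.
move=> mc; rewrite fin_predE; apply: fin_bigcup_measurable => // a _.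
by apply: fin_bigcap_measurable => [|i _]; [exact: finite_finset|exact: mc].
Qed.

Lemma probability_fin_pred (R : realType) (d : measure_display)
  (T : measurableType d) (P : probability T R) (I K : finType)
  (c : I -> T -> K) (Q : pred {ffun I -> K}) (w : K -> R) :
  (forall i x, measurable [set t | c i t = x]) ->
  (forall a : {ffun I -> K},
     P (\bigcap_i [set t | c i t = a i]) = (wprod w a)%:E) ->
  P [set t | Q [ffun i => c i t]] = (\sum_(a | Q a) wprod w a)%:E.
Proof.
move=> mc Pc; rewrite fin_predE measure_fin_bigcup //.
- rewrite -fsbig_seq ?enum_uniq // big_enum_cond /= -sumEFin.
  by apply: eq_big => [a|a _]; rewrite ?andbT ?Pc.
- move=> a b _ _ [t [ta tb]]; apply/ffunP => i.
  by rewrite -(ta i) // -(tb i).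
- move=> a _; apply: fin_bigcap_measurable => [|i _]; last exact: mc.
  exact: finite_finset.
Qed.

Lemma measurable_ostat (R : realType) (d : measure_display)
  (T : measurableType d) (Z : nat -> T -> R) (n k : nat) :
  (0 < k <= n)%N -> (forall i, (i < n)%N -> measurable_fun setT (Z i)) ->
  measurable_fun setT (ostat Z n k).
Proof.
move=> kn mZ; apply: (measurability _ (measurable_realfun.RGenOInfty.measurableE R)).
move=> _ [_ [x ->] <-]; rewrite setTI.
have mle (i : 'I_n) : measurable [set t | Z i t <= x].
  rewrite -[X in measurable X]setTI; apply: measurable_fun_le => //.
  exact: mZ.
(* The order statistic exceeds [x] when fewer than [k] variables are at most [x], so the event
   depends on [n] booleans only. *)
pose c (i : 'I_n) t := Z i t <= x.
pose Q (a : {ffun 'I_n -> bool}) := (#|[pred i | a i]| < k)%N.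
have -> : ostat Z n k @^-1` `]x, +oo[ = [set t | Q [ffun i => c i t]].
  apply/seteqP; rewrite /Q; split=> t /=; rewrite in_itv /= andbT ltNge ostat_le //.
    rewrite -ltnNge; congr (_ < _)%N; apply: eq_card => i.
    by rewrite !inE ffunE.
  rewrite -ltnNge; congr (_ < _)%N; apply: eq_card => i.
  by rewrite !inE ffunE.
apply: measurable_fin_pred => i [].
  exact: mle.
rewrite (_ : [set t | c i t = false] = ~` [set t | Z i t <= x]).
  exact: measurableC.
by apply/seteqP; rewrite /c; split=> t /=; [move=>/negbT/negP|move=> /negP/negbTE].
Qed.

(** * Cdfs, quantiles and cells *)

Lemma cdf_nd (R : realType) (d : measure_display) (T : measurableType d)
  (P : probability T R) (Z : T -> R) (F : R -> R) :
  measurable_fun setT Z -> has_cdf P Z F -> {homo F : x y / x <= y}.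
Proof.
move=> mZ ZF x y xy; rewrite -lee_fin -!ZF; apply: le_measure.
- by rewrite inE -[X in measurable X]setTI; exact: measurable_fun_le.
- by rewrite inE -[X in measurable X]setTI; exact: measurable_fun_le.
- by move=> t /= /le_trans; exact.
Qed.

Lemma cdf_limits (R : realType) (d : measure_display) (T : measurableType d)
  (P : probability T R) (Z : T -> R) (F : R -> R) (u : R) :
  measurable_fun setT Z -> has_cdf P Z F -> 0 < u < 1 ->
  (exists a, F a < u) /\ (exists b, u < F b).
Proof.
move=> mZ ZF /andP[u0 u1].
(* Bundling [Z] as a random variable gives access to the limits of [cdf] at both infinities; the
   shifts by 1 below land strictly beyond the threshold [M]. *)
pose X : {RV P >-> R} := mfun_Sub (mem_set mZ).
have XF r : cdf X r = (F r)%:E.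
  by rewrite -ZF (_ : [set t | Z t <= r] = X @^-1` `]-oo, r]).
split.
- have [|M [_ HM]] := @cvg_cdfNy0 _ _ _ _ X [set y | (y < u%:E)%E].
    by apply: open_ereal_lt'; rewrite lte_fin.
  exists (M - 1); have /= := HM (M - 1).
  by rewrite XF lte_fin; apply; lra.
- have [|M [_ HM]] := @cvg_cdfy1 _ _ _ _ X [set y | (u%:E < y)%E].
    by apply: open_ereal_gt'; rewrite lte_fin.
  exists (M + 1); have /= := HM (M + 1).
  by rewrite XF lte_fin; apply; lra.
Qed.

(** The points [a] and [b] make the defining set bounded below and nonempty. The intermediate value
    theorem gives a point of value [u], to the right of the infimum, hence [<=]. A value below [u]
    at the infimum would persist nearby by continuity, and the set would have no point close to its
    infimum. *)
Lemma qinvK (R : realType) (F : R -> R) (u a b : R) :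
  continuous F -> {homo F : x y / x <= y} -> F a < u -> u < F b ->
  F (qinv F u) = u.
Proof.
move=> cF ndF Fa Fb; set S := [set x | u <= F x].
have lbS : has_lbound S.
  exists a => x; rewrite /S /= => ux; rewrite leNgt; apply/negP => xa.
  by have := ndF _ _ (ltW xa); lra.
have infS : has_inf S by split => //; exists b; exact: ltW.
have ab : a <= b.
  by rewrite leNgt; apply/negP => ba; have := ndF _ _ (ltW ba); lra.
apply/eqP; rewrite eq_le; apply/andP; split.
  have [y _ Fy] : exists2 c, c \in `[a, b] & F c = u.
    apply: IVT => //; first exact: continuous_subspaceT.
    by rewrite ge_min le_max (ltW Fa) (ltW Fb) orbT.
  by rewrite -[leRHS]Fy; apply: ndF; apply: ge_inf => //; rewrite /S /= Fy.
rewrite leNgt; apply/negP => Fq.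
have [e /= e0 He] : \forall x \near qinv F u, F x < u.
  exact: (cvgr_lt _ (cF (qinv F u))).
have [x Sx xq] := inf_adherent e0 infS.
have qx : qinv F u <= x by exact: ge_inf.
have : F x < u.
  apply: He; rewrite /ball /= ler0_norm ?subr_le0 //.
  by move: xq; rewrite -/(qinv F u); lra.
by move: Sx; rewrite /S /=; lra.
Qed.

(* Cell [j] is the interval [(q_j, q_(j+1)]], with [q_0 = -oo] and
   [q_(N+1) = +oo]: the values [q 0] and [q N.+1] are never used. *)
Definition cell {R : realType} (N : nat) (q : nat -> R) (x : R) : 'I_N.+1 :=
  inord (find (fun m => x <= q m.+1) (iota 0 N)).

(** [find] returns the first [m] with [x <= q m.+1], or [N] if there is none; monotonicity of [q]
    carries the inequality from that [m] to [j]. *)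
Lemma cell_le (R : realType) (N : nat) (q : nat -> R) (x : R) (j : nat) :
  (forall m m', (m <= m' < N)%N -> q m.+1 <= q m'.+1) -> (j < N)%N ->
  (cell N q x <= j)%N = (x <= q j.+1).
Proof.
move=> ndq jN; rewrite /cell.
set f := find _ _; have fN : (f <= N)%N.
  by rewrite -[X in (_ <= X)%N](size_iota 0) find_size.
rewrite inordK //; apply/idP/idP => [fj|xq].
  have fN' : (f < N)%N by exact: leq_ltn_trans jN.
  have := @nth_find _ 0%N (fun m => x <= q m.+1) (iota 0 N).
  rewrite has_find size_iota -/f => /(_ fN'); rewrite nth_iota // add0n.
  by move=> /le_trans; apply; apply: ndq; rewrite fj.
rewrite leqNgt; apply/negP => /(@before_find _ 0%N).
by rewrite nth_iota // add0n xq.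
Qed.

Lemma cell_le_max (R : realType) (N : nat) (q : nat -> R) (x : R) (j : nat) :
  (N <= j)%N -> (cell N q x <= j)%N.
Proof. by move=> Nj; apply: leq_trans Nj; rewrite -ltnS. Qed.

Lemma measurable_cell (R : realType) (N : nat) (q : nat -> R) (x : 'I_N.+1) :
  (forall m m', (m <= m' < N)%N -> q m.+1 <= q m'.+1) ->
  measurable [set y | cell N q y = x].
Proof.
move=> ndq.
have mle j : measurable [set y | (cell N q y <= j)%N].
  have [jN|Nj] := ltnP j N.
    rewrite (_ : [set y | _] = `]-oo, q j.+1]%classic) //.
    by apply/seteqP; split=> y /=; rewrite in_itv /= cell_le.
  rewrite (_ : [set y | _] = setT) //.
  by apply/seteqP; split=> y //= _; exact: cell_le_max.
(* A cell is the difference of two consecutive lower sets, except cell 0, which is itself a lower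
   set. *)
case: (posnP x) => x0.
  rewrite (_ : [set y | _] = [set y | (cell N q y <= 0)%N]) //.
  apply/seteqP; split=> y /=; first by move=> ->; rewrite x0.
  by rewrite leqn0 => /eqP yx; apply/val_inj; rewrite /= yx x0.
rewrite (_ : [set y | _] =
  [set y | (cell N q y <= x)%N] `\` [set y | (cell N q y <= x.-1)%N]).
  exact: measurableD.
apply/seteqP; split=> y /=.
  by move=> ->; split=> //; apply/negP; rewrite -ltnNge prednK.
move=> [yx /negP]; rewrite -ltnNge prednK // => xy.
by apply/val_inj/eqP; rewrite /= eqn_leq yx.
Qed.

(** The cells up to [j] have total probability [(j + 1) / (N + 1)], by the value of [F] at the right
    end of cell [j], or because they cover the line when [j = N]. Consecutive differences are
    constant. *)
Lemma probability_cell (R : realType) (d : measure_display)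
  (T : measurableType d) (P : probability T R) (Z : T -> R) (F : R -> R)
  (N : nat) (q : nat -> R) (x : 'I_N.+1) :
  measurable_fun setT Z -> has_cdf P Z F ->
  (forall m m', (m <= m' < N)%N -> q m.+1 <= q m'.+1) ->
  (forall m, (m < N)%N -> F (q m.+1) = m.+1%:R / N.+1%:R) ->
  P [set t | cell N q (Z t) = x] = (N.+1%:R^-1)%:E.
Proof.
move=> mZ ZF ndq Fq.
have PLE j : (j <= N)%N ->
    P [set t | (cell N q (Z t) <= j)%N] = (j.+1%:R / N.+1%:R)%:E.
  rewrite leq_eqVlt => /orP[/eqP ->|jN].
    rewrite divff ?pnatr_eq0 // -[RHS](probability_setT P); congr (P _).
    by apply/seteqP; split=> t //= _; exact: cell_le_max.
  rewrite -Fq // -ZF; congr (P _).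
  by apply/seteqP; split=> t /=; rewrite cell_le.
have mle j : measurable [set t | (cell N q (Z t) <= j)%N].
  have [jN|Nj] := ltnP j N.
    rewrite (_ : [set t | _] = setT `&` [set t | Z t <= q j.+1]).
      exact: measurable_fun_le.
    by rewrite setTI; apply/seteqP; split=> y /=; rewrite cell_le.
  rewrite (_ : [set y | _] = setT) //.
  by apply/seteqP; split=> y //= _; exact: cell_le_max.
have xN : (x <= N)%N by rewrite -ltnS.
case: (posnP x) => x0.
  rewrite -[X in X%:E]mul1r -(PLE 0%N) //; congr (P _).
  apply/seteqP; split=> t /=; first by move=> ->; rewrite x0.
  by rewrite leqn0 => /eqP yx; apply/val_inj; rewrite /= yx x0.
rewrite (_ : [set t | _] =
  [set t | (cell N q (Z t) <= x)%N] `\` [set t | (cell N q (Z t) <= x.-1)%N]).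
  rewrite measureD // ?(le_lt_trans (probability_le1 _ _)) ?ltry //.
  rewrite setIidr; last by move=> t /= /leq_trans; apply; exact: leq_pred.
  transitivity (P [set t | (cell N q (Z t) <= x)%N] -
    P [set t | (cell N q (Z t) <= x.-1)%N])%E; first by [].
  rewrite !PLE // ?(leq_trans (leq_pred _)) // -EFinB prednK //.
  by congr EFin; rewrite -mulrBl -natr1 addrAC subrr add0r mul1r.
apply/seteqP; split=> t /=.
  by move=> ->; split=> //; apply/negP; rewrite -ltnNge prednK.
move=> [yx /negP]; rewrite -ltnNge prednK // => xy.
by apply/val_inj/eqP; rewrite /= eqn_leq yx.
Qed.

(** * From the samples to the uniform model *)

(** The mass on the left is that of cell configurations forcing the strict inequality. Between [lo]
    and [hi] the quantile functions are known to be ordered. *)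
Lemma probability_ostat_lt (R : realType) (d : measure_display)
  (T : measurableType d) (P : probability T R) (FX FY : R -> R)
  (X Y : nat -> T -> R) (n k N : nat) (lo hi : R) :
  continuous FX -> continuous FY ->
  (forall i, (i < n)%N -> measurable_fun setT (X i)) ->
  (forall i, (i < n)%N -> measurable_fun setT (Y i)) ->
  (forall i, (i < n)%N -> has_cdf P (X i) FX) ->
  (forall i, (i < n)%N -> has_cdf P (Y i) FY) ->
  indep2 P n X Y -> (0 < k <= n)%N ->
  (forall u : R, 0 < u < 1 -> lo < u < hi -> qinv FX u <= qinv FY u) ->
  ((\sum_(a : {ffun bool * 'I_n -> 'I_N.+1} |
     (ordnat k (fun i => a (true, i)) < ordnat k (fun i => a (false, i)))%N &&
     (lo < (ordnat k (fun i => a (true, i))).+1%:R / N.+1%:R < hi))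
       wprod (fun=> N.+1%:R^-1) a)%:E
   <= P [set t | (ostat X n k t < ostat Y n k t)%R])%E.
Proof.
move=> cX cY mX mY XF YF ind kn qXY.
have n0 : (0 < n)%N by case/andP: kn => /leq_trans; exact.
pose qs (F : R -> R) m := qinv F (m%:R / N.+1%:R).
have grid m : (m < N)%N -> 0 < (m.+1%:R / N.+1%:R : R) < 1.
  by move=> mN; rewrite divr_gt0 //= ltr_pdivrMr // mul1r ltr_nat.
have qsP (Z : T -> R) (F : R -> R) : continuous F -> measurable_fun setT Z ->
    has_cdf P Z F ->
    (forall m, (m < N)%N -> F (qs F m.+1) = m.+1%:R / N.+1%:R) /\
    (forall m m', (m <= m' < N)%N -> qs F m.+1 <= qs F m'.+1).
  move=> cF mZ ZF.
  have FK m : (m < N)%N -> F (qs F m.+1) = m.+1%:R / N.+1%:R.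
    move=> mN; have [[a Fa] [b Fb]] := cdf_limits mZ ZF (grid m mN).
    by apply: (@qinvK _ _ _ a b) => //; exact: cdf_nd ZF.
  split=> // m m' /andP[mm' m'N].
  move: mm'; rewrite leq_eqVlt => /orP[/eqP -> //|mm'].
  rewrite leNgt; apply/negP => /ltW /(cdf_nd mZ ZF).
  rewrite !FK // ?(ltn_trans mm') // ler_pM2r ?invr_gt0 // ler_nat ltnS.
  by rewrite leqNgt mm'.
have [FXq ndX] := qsP _ _ cX (mX _ n0) (XF _ n0).
have [FYq ndY] := qsP _ _ cY (mY _ n0) (YF _ n0).
pose c (z : bool * 'I_n) t :=
  if z.1 then cell N (qs FX) (X z.2 t) else cell N (qs FY) (Y z.2 t).
have mc z x : measurable [set t | c z t = x].
  case: z => -[] i; rewrite /c /=.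
    have := mX i (ltn_ord i) measurableT _ (measurable_cell x ndX).
    by rewrite setTI.
  have := mY i (ltn_ord i) measurableT _ (measurable_cell x ndY).
  by rewrite setTI.
set Q := (X in \sum_(a | X a) _).
rewrite -(probability_fin_pred (P := P) Q mc) => [|a]; last first.
  (* [indep2] takes sets indexed by all naturals: from index [n] on, the whole line is used. *)
  pose B i := oapp (fun j => [set x | cell N (qs FX) x = a (true, j)]) setT
    (insub i : option 'I_n).
  pose C i := oapp (fun j => [set x | cell N (qs FY) x = a (false, j)]) setT
    (insub i : option 'I_n).
  have mB i : measurable (B i).
    by rewrite /B; case: insub => //= j; exact: measurable_cell.
  have mC i : measurable (C i).
    by rewrite /C; case: insub => //= j; exact: measurable_cell.
  rewrite (_ : \bigcap_i _ = \bigcap_(i in `I_n) (X i @^-1` B i) `&`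
    \bigcap_(i in `I_n) (Y i @^-1` C i)); last first.
    apply/seteqP; split=> [t ct|t [BX CY] [b i] _].
      split=> i /= il; rewrite /B /C insubT /=.
        by have := ct (true, Ordinal il) I.
      by have := ct (false, Ordinal il) I.
    case: b; rewrite /c /=.
      by have := BX i (ltn_ord i); rewrite /B /= valK.
    by have := CY i (ltn_ord i); rewrite /C /= valK.
  rewrite ind // (eq_bigr (fun=> (N.+1%:R^-1)%:E)) => [|i _]; last first.
    rewrite /B valK /=.
    exact: (probability_cell _ (mX _ _) (XF _ _)).
  rewrite [X in (_ * X)%E](eq_bigr (fun=> (N.+1%:R^-1)%:E)) => [|i _]; last first.
    rewrite /C valK /=.
    exact: (probability_cell _ (mY _ _) (YF _ _)).
  rewrite !prodEFin -EFinM /wprod !prodr_const card_prod card_bool card_ord.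
  by rewrite -exprD addnn mul2n.
apply: le_measure.
- by rewrite inE; exact: measurable_fin_pred.
- rewrite inE (_ : [set t | _] = ~` (setT `&` [set t | ostat Y n k t <= ostat X n k t])).
    by apply: measurableC; apply: measurable_fun_le => //; exact: measurable_ostat.
  by rewrite setTI; apply/seteqP; split=> t /=; rewrite ltNge => /negP.
move=> t; rewrite /Q /=.
set oX := ordnat k _; set oY := ordnat k _ => /andP[oXY oXlh].
have oYN : (oY <= N)%N.
  rewrite /oY; set b := (X in ordnat k X).
  by have [i ->] := ordnat_in b kn; exact: leq_ord.
(* Because [oX < oY <= N], cell [oX] is not the last one, so its right end is a quantile of order
   inside [(0, 1)]. *)
have oXN : (oX < N)%N by exact: leq_trans oYN.
(* At least [k] of the X cells are at most [oX], so as many X values are at most its right end. *)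
have lX : ostat X n k t <= qs FX oX.+1.
  rewrite ostat_le //; have := leqnn oX; rewrite {1}/oX ordnat_le //.
  move=> /leq_trans; apply; apply: subset_leq_card; apply/fintype.subsetP => i.
  by rewrite !inE ffunE /c /= cell_le.
(* Otherwise [k] of the Y cells would be at most [oX], forcing [oY <= oX]. *)
have lY : qs FY oX.+1 < ostat Y n k t.
  rewrite ltNge ostat_le //; apply/negP => kY.
  suff : (oY <= oX)%N by rewrite leqNgt oXY.
  rewrite ordnat_le //; apply: leq_trans kY _.
  apply: subset_leq_card; apply/fintype.subsetP => i.
  by rewrite !inE ffunE /c /= cell_le.
apply: le_lt_trans lX _; apply: le_lt_trans lY.
by apply: qXY => //; exact: grid.
Qed.

(** * Deviation bounds in the uniform model *)

Lemma sum_uniform (R : realFieldType) (N : nat) :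
  \sum_(x : 'I_N.+1) N.+1%:R^-1 = 1 :> R.
Proof. by rewrite sumr_const card_ord -[_ *+ _]mulr_natl divff ?pnatr_eq0. Qed.

Lemma sum_uniform_le (R : realFieldType) (N j : nat) :
  \sum_(x : 'I_N.+1 | (x <= j)%N) N.+1%:R^-1 =
  (minn j.+1 N.+1)%:R / N.+1%:R :> R.
Proof.
rewrite sumr_const -[LHS]mulr_natl; congr (_%:R / _).
rewrite -sum1_card (eq_bigl (fun x : 'I_N.+1 => (x < j.+1)%N)) //.
have [jN|Nj] := leqP j.+1 N.+1.
  by rewrite -(big_ord_widen _ (fun=> 1%N) jN) sum1_card card_ord.
rewrite (eq_bigl predT) ?sum1_card ?card_ord // => x.
by rewrite (ltn_trans (ltn_ord x)).
Qed.

(** On this event at least [k] coordinates lie in the cells below [lo], where at most [n * lo] are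
    expected: a deviation of at least [r]. *)
Lemma sum_uniform_ordnat_lo (R : realType) (n k N : nat) (lo r : R) :
  (0 < k <= n)%N -> 0 < r -> r <= k%:R - n%:R * lo ->
  \sum_(a : {ffun bool * 'I_n -> 'I_N.+1} |
    (ordnat k (fun i => a (true, i))).+1%:R / N.+1%:R <= lo)
    wprod (fun=> N.+1%:R^-1) a <= n%:R / r ^+ 2.
Proof.
move=> kn r0 rk; set w : 'I_N.+1 -> R := fun=> _.
have M0 : 0 < N.+1%:R :> R by [].
have w0 x : 0 <= w x by rewrite invr_ge0.
have w1 : \sum_x w x = 1 by exact: sum_uniform.
(* Chebyshev's inequality is applied to the coordinates of the first sample only. *)
have inj : injective (fun i : 'I_n => (true, i)) by move=> i j [].
have rhs0 : 0 <= n%:R / r ^+ 2 :> R by rewrite divr_ge0 ?ler0n ?exprn_ge0 ?(ltW r0).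
(* The event says that the cell index plus 1 is at most [m]; it is empty when [m = 0]. *)
pose m := Num.truncn (N.+1%:R * lo).
case m0 : m => [|m'].
  rewrite big_pred0 // => a; apply/negbTE; rewrite -ltNge.
  rewrite ltr_pdivlMr // mulrC.
  have : N.+1%:R * lo < 1%:R by rewrite -truncn_le_nat -/m m0.
  by move=> /lt_le_trans; apply; rewrite ler_nat.
have lo0 : 0 <= N.+1%:R * lo.
  by apply: le_trans (ler01) _; rewrite -truncn_gt0 -/m m0.
have := sum_wprod_chebyshev (fun x : 'I_N.+1 => x <= m')%N inj w0 w1 r0.
rewrite card_ord; apply: le_trans.
rewrite big_mkcond [leRHS]big_mkcond /=; apply: ler_sum => a _.
case: ifP => [olo|_]; last by case: ifP => // _; exact: wprod_ge0.
rewrite ifT //.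
have om : (ordnat k (fun i => a (true, i)) <= m')%N.
  rewrite -ltnS -m0 /m truncn_ge_nat // mulrC.
  by rewrite -ler_pdivrMr.
rewrite ordnat_le // in om.
rewrite (le_trans _ (ler_norm _)) // sum_uniform_le.
apply: le_trans rk _; rewrite lerB ?ler_nat // ler_wpM2l //.
rewrite ler_pdivrMr // mulrC; apply: (@le_trans _ _ m'.+1%:R).
  by rewrite ler_nat geq_minl.
by rewrite -m0 truncn_le.
Qed.

(** With [m] the integer part of [(N + 1) * hi], fewer than [k] coordinates lie in the [m - 1] cells
    up to [m.-2]. Rounding and the shift by one cell cost at most 2 cells, hence at most
    [2 * n / (N + 1) <= 2] in the expected count: this is the 2 in the hypothesis. *)
Lemma sum_uniform_ordnat_hi (R : realType) (n k N : nat) (hi r : R) :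
  (0 < k <= n)%N -> (n <= N)%N -> 0 < r -> r <= n%:R * hi - k%:R - 2 ->
  \sum_(a : {ffun bool * 'I_n -> 'I_N.+1} |
    hi <= (ordnat k (fun i => a (true, i))).+1%:R / N.+1%:R)
    wprod (fun=> N.+1%:R^-1) a <= n%:R / r ^+ 2.
Proof.
move=> kn nN r0 rk; set w : 'I_N.+1 -> R := fun=> _.
have M0 : 0 < N.+1%:R :> R by [].
have w0 x : 0 <= w x by rewrite invr_ge0.
have w1 : \sum_x w x = 1 by exact: sum_uniform.
have inj : injective (fun i : 'I_n => (true, i)) by move=> i j [].
have nM : n%:R <= N.+1%:R :> R by rewrite ler_nat leqW.
have n0 : 0 <= n%:R :> R by [].
have k0 : 0 <= k%:R :> R by [].
have hi0 : 0 < hi by nra.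
(* This ensures [2 <= m], so that [m.-2] is a genuine subtraction. *)
have Mhi : 2 < N.+1%:R * hi by nra.
pose m := Num.truncn (N.+1%:R * hi).
have m2 : (2 <= m)%N by rewrite truncn_ge_nat ltW //; lra.
have mhi : m%:R <= N.+1%:R * hi by rewrite truncn_le mulr_ge0 // ltW.
have him : N.+1%:R * hi < m%:R + 1 by rewrite natr1 truncnS_gt.
have := sum_wprod_chebyshev (fun x : 'I_N.+1 => x <= m.-2)%N inj w0 w1 r0.
rewrite card_ord; apply: le_trans.
rewrite big_mkcond [leRHS]big_mkcond /=; apply: ler_sum => a _.
case: ifP => [ohi|_]; last by case: ifP => // _; exact: wprod_ge0.
rewrite ifT //.
have mo : (m <= (ordnat k (fun i => a (true, i))).+1)%N.
  rewrite -(ler_nat R); apply: le_trans mhi _.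
  by rewrite mulrC -ler_pdivlMr.
have oN : (ordnat k (fun i => a (true, i)) <= N)%N.
  set b := (X in ordnat k X).
  by have [i ->] := ordnat_in b kn; exact: leq_ord.
have om : ~~ (ordnat k (fun i => a (true, i)) <= m.-2)%N.
  by rewrite -ltnNge -ltnS; apply: leq_trans mo; case: (m) m2 => [|[]].
rewrite ordnat_le // -ltnNge -(ltr_nat R) in om.
rewrite ler_normr; apply/orP; right; rewrite sum_uniform_le.
have -> : (minn m.-2.+1 N.+1) = m.-1.
  have -> : m.-2.+1 = m.-1 by case: (m) m2 => [|[]].
  by apply/minn_idPl; rewrite -subn1 leq_subLR add1n (leq_trans mo) // ltnS leqW.
have m1 : m.-1%:R = m%:R - 1 :> R by case: (m) m2 => // m' _; rewrite -natr1 addrK.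
rewrite m1 opprB.
have q : hi - 2 / N.+1%:R <= (m%:R - 1) / N.+1%:R.
  rewrite ler_pdivlMr // mulrBl divfK ?gt_eqF //; lra.
have nq : n%:R * (hi - 2 / N.+1%:R) <= n%:R * ((m%:R - 1) / N.+1%:R).
  by rewrite ler_wpM2l.
have n2 : n%:R * (2 / N.+1%:R) <= 2 :> R.
  by rewrite mulrCA ler_piMr // ler_pdivrMr // mul1r.
move: nq; rewrite mulrBr => nq.
rewrite lerBrDr; apply: le_trans (lerD (lexx r) (ltW om)) _. apply: le_trans nq.
by move: n2 rk; set y := n%:R * (2 / _); lra.
Qed.

(** From the mass of the strict ordering, remove the two deviation events at [lo] and [hi]. *)
Lemma sum_uniform_ordnat_near (R : realType) (n k N : nat) (lo hi r : R) :
  (0 < k <= n)%N -> (n ^ 3 <= N)%N -> 0 < r ->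
  r <= k%:R - n%:R * lo -> r <= n%:R * hi - k%:R - 2 ->
  1 / 2 - n%:R^-1 - 2 * (n%:R / r ^+ 2) <=
  \sum_(a : {ffun bool * 'I_n -> 'I_N.+1} |
     (ordnat k (fun i => a (true, i)) < ordnat k (fun i => a (false, i)))%N &&
     (lo < (ordnat k (fun i => a (true, i))).+1%:R / N.+1%:R < hi))
       wprod (fun=> N.+1%:R^-1) a.
Proof.
move=> kn nN r0 rlo rhi; set w : 'I_N.+1 -> R := fun=> _.
have n0 : (0 < n)%N by case/andP: kn => /leq_trans; exact.
have w0 x : 0 <= w x by rewrite invr_ge0.
have w1 : \sum_x w x = 1 by exact: sum_uniform.
have n3 : (n <= N)%N by apply: leq_trans nN; rewrite -[X in (X <= _)%N]expn1 leq_pexp2l.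
have Hlt := sum_wprod_ordnat_lt kn w0 w1.
have Hlo := sum_uniform_ordnat_lo N kn r0 rlo.
have Hhi := sum_uniform_ordnat_hi kn n3 r0 rhi.
set S1 := (X in _ <= 2 * X) in Hlt; set S2 := \sum_(a | _) _ in Hlo.
set S3 := \sum_(a | _) _ in Hhi; set S := \sum_(a | _) _.
have cover : S1 <= S + S2 + S3.
  rewrite /S1 /S /S2 /S3 big_mkcond [X in X + _ + _]big_mkcond.
  rewrite [X in _ + X + _]big_mkcond [X in _ + _ + X]big_mkcond /=.
  rewrite -!big_split /=; apply: ler_sum => a _.
  have wa := wprod_ge0 a w0.
  case: ltnP => _ /=; last by do 2 case: ifP => _; lra.
  case: (ltP lo) => _ /=; last by case: ifP => _; lra.
  by case: ltP => _; lra.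
(* The tie bound is [n ^ 2 / (N + 1)], and [n ^ 3 <= N] brings it below [1 / n]. *)
have Hw : (n ^ 2)%:R * \sum_x w x ^+ 2 <= n%:R^-1.
  rewrite /w sumr_const card_ord -[X in _ * X]mulr_natl expr2 [X in _ * X]mulrA divff ?pnatr_eq0 // mul1r.
  rewrite ler_pdivrMr // -ler_pdivrMl ?invr_gt0 ?ltr0n // invrK -natrM ler_nat.
  by apply: leqW; apply: leq_trans nN; rewrite -expnS.
have ni0 : 0 <= n%:R^-1 :> R by rewrite invr_ge0.
lra.
Qed.

(** * The asymptotic lower bound *)

Lemma kn_bounds (R : realType) (g : nat -> R) (n : nat) :
  (0 < n)%N -> 0 <= g n <= 1 ->
  [/\ (0 < kn g n <= n)%N, (n.-1)%:R * g n <= (kn g n)%:R &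
      (kn g n)%:R <= 1 + (n.-1)%:R * g n].
Proof.
move=> n0 /andP[g0 g1]; have x0 : 0 <= (n.-1)%:R * g n by rewrite mulr_ge0.
have -> : kn g n = (Num.truncn ((n.-1)%:R * g n)).+1.
  by rewrite /kn truncn_floor x0.
have /andP[lo hi] := truncn_itv x0; split.
- rewrite /= -[X in (_ <= X)%N](prednK n0) ltnS -(ler_nat R).
  by apply: le_trans lo _; rewrite ler_piMr.
- exact: ltW.
- by rewrite -natr1 addrC lerD2l.
Qed.

Lemma dist_gt0 (R : realType) (x : R) (A : set R) : (0 < dist x A)%E ->
  exists2 e : R, 0 < e & forall y, A y -> e <= `|x - y|.
Proof.
move=> dA.
have dle y : A y -> (dist x A <= `|x - y|%:E)%E.
  by move=> Ay; apply: ereal_inf_lbound; exists y.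
case: (dist x A) dA dle => [e| |] //; rewrite ?lte_fin => e0 dle.
  by exists e => // y /dle; rewrite lee_fin.
(* An infinite distance means that [A] is empty, so any radius works. *)
by exists 1 => // y /dle; rewrite leye_eq.
Qed.

(** The strict inequality lets this bound, with the samples exchanged, also give an upper bound by
    complementation. *)
Lemma probability_ostat_lt_ge (R : realType) (d : measure_display)
  (T : measurableType d) (P : probability T R) (FX FY : R -> R)
  (X Y : nat -> nat -> T -> R) (g : nat -> R) (gam : R) :
  continuous FX -> continuous FY ->
  (forall n i, (i < n)%N -> measurable_fun setT (X n i)) ->
  (forall n i, (i < n)%N -> measurable_fun setT (Y n i)) ->
  (forall n i, (i < n)%N -> has_cdf P (X n i) FX) ->
  (forall n i, (i < n)%N -> has_cdf P (Y n i) FY) ->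
  (forall n, indep2 P n (X n) (Y n)) ->
  (forall n, 0 <= g n <= 1) ->
  (exists C : R, forall n, (0 < n)%N -> `|g n - gam| <= C / n%:R) ->
  (0 < dist gam (A0 FX FY))%E ->
  forall e : R, 0 < e -> \forall n \near \oo,
    ((1 / 2 - e)%:E <=
      P [set t | (ostat (X n) n (kn g n) t < ostat (Y n) n (kn g n) t)%R])%E.
Proof.
move=> cX cY mX mY XF YF ind g01 [C gC] /dist_gt0[h h0 hA] e e0.
have qXY u : 0 < u < 1 -> gam - h < u < gam + h -> qinv FX u <= qinv FY u.
  move=> u01 /andP[ul uh]; rewrite leNgt; apply/negP => qYX.
  have := hA u (conj u01 qYX); apply/negP; rewrite -ltNge ltr_norml.
  by apply/andP; split; lra.
(* With [r = n * h / 2], the error [1 / n + 2 * n / r ^ 2] equals [D / n]. *)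
pose D : R := 1 + 8 / h ^+ 2.
near=> n.
have n0 : (0 < n)%N by near: n; exists 1%N.
have nR0 : 0 < n%:R :> R by rewrite ltr0n.
(* Half of the margin [n * h] absorbs the error [C] on [n * g n], the 1 in [kn] and the 2 of the
   upper deviation bound; the other half remains as [r]. *)
have hn : C + 3 <= n%:R * h / 2.
  have : 2 * (C + 3) / h <= n%:R by near: n; exact: nbhs_infty_ger.
  by rewrite ler_pdivrMr //; lra.
have Dn : D / n%:R <= e.
  have : D / e <= n%:R by near: n; exact: nbhs_infty_ger.
  by rewrite ler_pdivrMr // ler_pdivrMr // [e * _]mulrC.
have /(kn_bounds n0)[kn klo khi] := g01 n.
have /andP[g0 g1] := g01 n.
have n1 : n.-1%:R = n%:R - 1 :> R by rewrite -[in RHS](prednK n0) -natr1 addrK.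
rewrite n1 in klo khi.
have [gl gh] : n%:R * gam - C <= n%:R * g n /\ n%:R * g n <= n%:R * gam + C.
  have := gC _ n0; rewrite ler_pdivlMr // mulrC -{1}(ger0_norm (ltW nR0)) -normrM.
  by rewrite ler_norml => /andP[]; rewrite mulrBr; split; lra.
have r0 : 0 < n%:R * h / 2 by rewrite !mulr_gt0 ?invr_gt0.
have rlo : n%:R * h / 2 <= (Defs.kn g n)%:R - n%:R * (gam - h) by nra.
have rhi : n%:R * h / 2 <= n%:R * (gam + h) - (Defs.kn g n)%:R - 2 by nra.
have := probability_ostat_lt (n ^ 3) cX cY (mX n) (mY n) (XF n) (YF n) (ind n)
  kn qXY.
apply: le_trans; rewrite lee_fin.
apply: le_trans (sum_uniform_ordnat_near kn (leqnn _) r0 rlo rhi).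
have E : n%:R^-1 + 2 * (n%:R / (n%:R * h / 2) ^+ 2) = D / n%:R.
  by rewrite /D; field; rewrite ?gt_eqF.
move: E Dn; set p := n%:R^-1; set q := 2 * (_ / _); lra.
Unshelve. all: by end_near.
Qed.

(** * Limits and the two claims *)

Lemma ge_limn_einf (R : realType) (u : nat -> \bar R) (c : R) :
  (forall e : R, 0 < e -> \forall n \near \oo, ((c - e)%:E <= u n)%E) ->
  (c%:E <= limn_einf u)%E.
Proof.
move=> uc; rewrite limn_einf_lim; apply/lee_addgt0Pr => e e0.
rewrite -leeBlDr // -EFinB.
have [N _ uN] := uc _ e0.
apply: lime_ge; first exact: is_cvg_einfs.
exists N => // n Nn /=; apply: le_ereal_inf_tmp => _ [m /= nm <-].
by apply: uN; exact: leq_trans nm.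
Qed.

Lemma cvge_between (R : realType) (u : nat -> \bar R) (c : R) :
  (forall e : R, 0 < e -> \forall n \near \oo, ((c - e)%:E <= u n)%E) ->
  (forall e : R, 0 < e -> \forall n \near \oo, (u n <= (c + e)%:E)%E) ->
  u @ \oo --> c%:E.
Proof.
move=> lu uu; apply/fine_cvgP; split.
  near=> n; apply/fin_real/andP; split.
    apply: (@lt_le_trans _ _ (c - 1)%:E); first exact: ltNyr.
    by near: n; exact: lu.
  apply: (@le_lt_trans _ _ (c + 1)%:E); last exact: ltry.
  by near: n; exact: uu.
apply/cvgrPdist_le => e e0; near=> n.
have : ((c - e)%:E <= u n)%E by near: n; exact: lu.
have : (u n <= (c + e)%:E)%E by near: n; exact: uu.
rewrite /=; case: (u n) => [r| |] //=; rewrite !lee_fin => rc cr.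
by rewrite ler_norml; apply/andP; split; lra.
Unshelve. all: by end_near.
Qed.

Lemma indep2C (d : measure_display) (T : measurableType d) (R : realType)
  (P : probability T R) (n : nat) (X Y : nat -> T -> R) :
  indep2 P n X Y -> indep2 P n Y X.
Proof. by move=> XY B C mB mC; rewrite setIC XY // muleC. Qed.

Theorem theorem3p13 (R : realType) (d : measure_display) (T : measurableType d)
  (P : probability T R) (FX FY : R -> R)
  (X Y : nat -> nat -> T -> R) (g : nat -> R) (gam : R) :
  continuous FX -> continuous FY ->
  (forall n i, (i < n)%N -> measurable_fun setT (X n i)) ->
  (forall n i, (i < n)%N -> measurable_fun setT (Y n i)) ->
  (forall n i, (i < n)%N -> has_cdf P (X n i) FX) ->
  (forall n i, (i < n)%N -> has_cdf P (Y n i) FY) ->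
  (forall n, indep2 P n (X n) (Y n)) ->
  (forall n, 0 <= g n <= 1) -> 0 <= gam <= 1 ->
  (exists C : R, forall n, (0 < n)%N -> `|g n - gam| <= C / n%:R) ->
  ((0 < dist gam (A0 FX FY))%E ->
     ((1/2)%:E <= limn_einf (fun n => P [set t | (ostat (X n) n (kn g n) t
                                               <= ostat (Y n) n (kn g n) t)%R]))%E) /\
  ((0 < dist gam (A2 FX FY))%E ->
     (fun n => P [set t | ostat (X n) n (kn g n) t <= ostat (Y n) n (kn g n) t])
       @ \oo --> (1/2)%:E).
Proof.
move=> cX cY mX mY XF YF ind g01 _ gC.
have mle n (Z W : nat -> nat -> T -> R) : (0 < n)%N ->
    (forall n i, (i < n)%N -> measurable_fun setT (Z n i)) ->
    (forall n i, (i < n)%N -> measurable_fun setT (W n i)) ->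
    measurable [set t | ostat (Z n) n (kn g n) t <= ostat (W n) n (kn g n) t].
  move=> n0 mZ mW; have [kn _ _] := kn_bounds n0 (g01 n).
  rewrite -[X in measurable X]setTI; apply: measurable_fun_le => //.
    exact: (measurable_ostat kn (mZ n)).
  exact: (measurable_ostat kn (mW n)).
have ltE n (Z W : nat -> nat -> T -> R) :
    [set t | ostat (Z n) n (kn g n) t < ostat (W n) n (kn g n) t] =
    ~` [set t | ostat (W n) n (kn g n) t <= ostat (Z n) n (kn g n) t].
  by apply/seteqP; split=> t /=; rewrite ltNge => /negP.
(* This eventual bound serves both claims: it gives the lower limit, and one half of the
   convergence. *)
have part1 : (0 < dist gam (A0 FX FY))%E -> forall e : R, 0 < e ->
    \forall n \near \oo, ((1 / 2 - e)%:E <= P [set t |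
      (ostat (X n) n (kn g n) t <= ostat (Y n) n (kn g n) t)%R])%E.
  move=> dA e e0; near=> n; have n0 : (0 < n)%N by near: n; exists 1%N.
  apply: (@le_trans _ _ (P [set t |
    (ostat (X n) n (kn g n) t < ostat (Y n) n (kn g n) t)%R])).
    by near: n; exact: (probability_ostat_lt_ge cX cY mX mY XF YF ind g01 gC dA e0).
  apply: le_measure; rewrite ?inE; [|exact: mle|by move=> t /= /ltW].
  by rewrite ltE; apply: measurableC; exact: mle.
split=> [dA|dA2]; first exact: ge_limn_einf (part1 dA).
have distS (A B : set R) : A `<=` B -> (dist gam B <= dist gam A)%E.
  move=> AB; apply: ereal_inf_le_tmp => _ [y Ay <-].
  by exists y => //; exact: AB.
(* [A2] contains both [A0 FX FY] and [A0 FY FX], so [gam] is at positive distance from each. *)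
apply: cvge_between.
  apply: part1; apply: lt_le_trans dA2 _; apply: distS => u [u01 qq].
  by split=> // qE; rewrite qE ltxx in qq.
move=> e e0; near=> n; have n0 : (0 < n)%N by near: n; exists 1%N.
(* The event with the samples exchanged is the complement of the one to be bounded above. *)
have : ((1 / 2 - e)%:E <= P [set t |
    (ostat (Y n) n (kn g n) t < ostat (X n) n (kn g n) t)%R])%E.
  near: n; apply: (probability_ostat_lt_ge cY cX mY mX YF XF _ g01 gC _ e0).
    by move=> n; exact: indep2C.
  apply: lt_le_trans dA2 _; apply: distS => u [u01 qq].
  by split=> // qE; rewrite qE ltxx in qq.
rewrite ltE probability_setC; last exact: mle.
have : P [set t | (ostat (X n) n (kn g n) t <= ostat (Y n) n (kn g n) t)%R]
    \is a fin_num by apply: fin_num_measure; exact: mle.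
by case: (P _) => //= r _; rewrite !lee_fin; lra.
Unshelve. all: by end_near.
Qed.
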